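(* Let $N\in\mathbb{N}$. Consider $N$ simple graphs $G_1,\dots,G_N$, $G_n=(E_n,V_n)$, of constant degree, i.e. $E_n$ has its values in $\{0,1\}$ and $d_{G_n}$ is constant (and finite) on $V_n$. Then for any graph $G$ obtained from $G_1,\dots,G_N$ by surgery, $\mathcal{A}_G$ is essentially self-adjoint on $\mathcal{C}_c(G)$.
   Context: A graph $G=(E,V)$ consists of a countable set $V$ (vertices) and a symmetric function $E:V\times V\to[0,\infty)$ (weights), with no loops: $E(x,x)=0$ for all $x$. Write $x\sim y$ if $E(x,y)\neq 0$. The degree of $x$ is $d_G(x):=|\{y\in V: E(x,y)\ne 0\}|$, and all graphs are locally finite (all degrees finite). The Hilbert space is the complex space $\ell^2(V)$, and $\mathcal{C}_c(G)$ is the set of finitely supported functions $V\to\mathbb{C}$. The adjacency matrix is the symmetric operator $(\mathcal{A}_{G,\circ}f)(x):=\sum_{y\sim x}E(x,y)f(y)$ for $f\in\mathcal{C}_c(G)$; its closure is $\mathcal{A}_G$. Essentially self-adjoint on $\mathcal{C}_c(G)$ means $\mathcal{A}_G=(\mathcal{A}_G)^*$. Surgery: given graphs $G_n=(E_n,V_n)$, choose vertices $x_n\in V_n$ and let $G^\circ=(E^\circ,V^\circ)$ be the disjoint union of the $G_n$. A graph $G=(E,V)$ is obtained by surgery from the $G_n$ if, for some such choice of the $x_n$ and some $M\ge 1$: $V=V^\circ$; $E(x,y)=E^\circ(x,y)$ whenever $x,y$ belong to the same $V_n$; for $x\in V_n$, $y\in V_m$ with $n\neq m$ one has $E(x,y)=0$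 unless $x=x_n$ and $y=x_m$; and $\sup_n\sum_m E(x_n,x_m)\leq M$. *)

(* Defs.v *)
From HB Require Import structures.
From mathcomp Require Import all_boot all_order all_algebra finmap.
From mathcomp Require Import mathcomp_extra boolp classical_sets functions.
From mathcomp Require Import cardinality fsbigop reals constructive_ereal ereal.
From mathcomp Require Import numfun esum complex.
Set Implicit Arguments.
Unset Strict Implicit.
Unset Printing Implicit Defensive.
Import Order.TTheory GRing.Theory Num.Theory.
Local Open Scope classical_set_scope.
Local Open Scope ring_scope.
Local Open Scope complex_scope.

(** * Weighted locally finite graphs *)

Record wgraph (R : realType) (V : countType) := WGraph {
  weight :> V -> V -> R ;
  weight_ge0 : forall x y, 0 <= weight x y ;
  weight_sym : forall x y, weight x y = weight y x ;
  weight_irr : forall x, weight x x = 0 ;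
  weight_locally_finite : forall x, finite_set [set y | weight x y != 0] }.

Definition neighbors (R : realType) (V : countType) (E : wgraph R V) (x : V) :
  set V := [set y | E x y != 0].

Definition degree (R : realType) (V : countType) (E : wgraph R V) (x : V) :
  nat := #|` fset_set (neighbors E x)|%fset.

Definition simple_graph (R : realType) (V : countType) (E : wgraph R V) : Prop :=
  forall x y, E x y = 0 \/ E x y = 1.

Definition constant_degree (R : realType) (V : countType) (E : wgraph R V) :
  Prop := exists d : nat, forall x, degree E x = d.

(** The vertex set of the disjoint union of the [E_ n] is [{n : I & V n}];
    [Tagged V u] is the vertex [u : V n] seen in it. *)
Definition surgery (R : realType) (I : countType) (V : I -> countType)
    (E_ : forall n, wgraph R (V n)) (E : wgraph R {n : I & V n}) : Prop :=
  exists (x : forall n, V n) (M : R),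
    [/\ 1 <= M,
        forall n (u v : V n), E (Tagged V u) (Tagged V v) = E_ n u v,
        forall n m (u : V n) (v : V m), n != m -> ~ (u = x n /\ v = x m) ->
          E (Tagged V u) (Tagged V v) = 0 &
        (ereal_sup [set \esum_(m in [set: I])
                          (E (Tagged V (x n)) (Tagged V (x m)))%:E
                   | n in [set: I]] <= M%:E)%E].

(** * The complex Hilbert space l^2(V) *)

(** As for the Lebesgue integral, the sum of a summable real family is the sum
    of its positive part minus that of its negative part. *)
Definition rsum (R : realType) (V : countType) (h : V -> R) : R :=
  let h' x := (h x)%:E in
  fine (\esum_(x in [set: V]) h'^\+ x - \esum_(x in [set: V]) h'^\- x)%E.

Definition csum (R : realType) (V : countType) (h : V -> R[i]) : R[i] :=
  rsum (fun x => complex.Re (h x)) +i* rsum (fun x => complex.Im (h x)).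

Definition l2normsq (R : realType) (V : countType) (f : V -> R[i]) : \bar R :=
  \esum_(x in [set: V]) ((Normc.normc (f x)) ^+ 2)%:E.

Definition l2 (R : realType) (V : countType) : set (V -> R[i]) :=
  [set f | (l2normsq f < +oo)%E].

Definition l2dot (R : realType) (V : countType) (f g : V -> R[i]) : R[i] :=
  csum (fun x => conjc (f x) * g x).

(** * Unbounded operators on l^2(V), identified with their graphs *)

Definition operator (R : realType) (V : countType) : Type :=
  set ((V -> R[i]) * (V -> R[i])).

(** The operator whose graph is the closure of that of [T] in l^2 x l^2. *)
Definition op_closure (R : realType) (V : countType) (T : operator R V) :
  operator R V :=
  [set p | [/\ l2 p.1, l2 p.2 &
     forall e : R, 0 < e -> exists2 q, T q &
       (l2normsq (q.1 \- p.1)%R < e%:E /\ l2normsq (q.2 \- p.2)%R < e%:E)%E]].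

(** [(f, g)] is in the graph of [T^*] iff [<f, T u> = <g, u>] for every [u] in
    the domain of [T]; this is the graph of an operator as soon as [T] is
    densely defined. *)
Definition op_adjoint (R : realType) (V : countType) (T : operator R V) :
  operator R V :=
  [set p | [/\ l2 p.1, l2 p.2 &
     forall q, T q -> l2dot p.1 q.2 = l2dot p.2 q.1]].

Definition essentially_selfadjoint (R : realType) (V : countType)
    (T : operator R V) : Prop :=
  op_closure T = op_adjoint (op_closure T).

(** * The adjacency matrix *)

Definition Cc (R : realType) (V : countType) : set (V -> R[i]) :=
  [set f | finite_set [set x | f x != 0]].

Definition adjacency_fun (R : realType) (V : countType) (E : wgraph R V)
    (f : V -> R[i]) : V -> R[i] :=
  fun x => \sum_(y \in neighbors E x) ((E x y)%:C * f y).

Definition adjacency (R : realType) (V : countType) (E : wgraph R V) :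
  operator R V :=
  [set (f, adjacency_fun E f) | f in @Cc R V].

(* Main.v *)
Require Import Defs.
From HB Require Import structures.
From mathcomp Require Import all_boot all_order all_algebra finmap.
From mathcomp Require Import mathcomp_extra boolp classical_sets functions.
From mathcomp Require Import cardinality fsbigop reals constructive_ereal ereal.
From mathcomp Require Import numfun esum complex.
From mathcomp Require Import ring lra.

(** A vertex of [G] that is none of the chosen vertices [x_n] has in [G] exactly
    the neighbours that it has in its own [G_n], each with weight [1], so its
    weights sum to the degree of [G_n].  Only [N] vertices are left, and each has
    a finite weight sum because [G] is locally finite.  As [N] is finite, the
    weight sums of all the vertices have a common bound [C]
    ([surgery_row_sum], [row_sum_simple]).

    By Schur's test ([l2normsq_adjacency_le]), weight sums bounded by [C] make
    the adjacency matrix [A] a bounded operator of norm at most [C].  Testing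
    [(f, g)] in the graph of the adjoint of [A] against the indicators of the
    vertices gives [g = A f] pointwise; the truncations of [f] to finite sets
    then converge to [f] in l^2, and so do their images to [A f], so [(f, g)] lies
    in the closure of [A] ([bounded_row_sum_essentially_selfadjoint]).

    This suffices by a general criterion
    ([symmetric_essentially_selfadjoint]): the inner product is continuous, hence
    an operator and its closure have the same adjoint, and a symmetric operator
    whose adjoint is contained in its closure is essentially self-adjoint.  The
    inner product is an unconditional sum of complex numbers, whose additivity
    and continuity come from those of sums of nonnegative families. *)

Set Implicit Arguments.
Unset Strict Implicit.
Unset Printing Implicit Defensive.
Import Order.TTheory GRing.Theory Num.Theory.
Local Open Scope classical_set_scope.
Local Open Scope ring_scope.
Local Open Scope complex_scope.

(** * Sums of nonnegative and of signed real families *)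

Section SummableFamilies.
Context {R : realType} {V : countType}.
Implicit Types (a b h k : V -> R) (F : set V).

(** The squared norm [l2normsq f] is, definitionally, the instance of this sum at
    the squared moduli of [f]. *)
Definition mass a : \bar R := (\esum_(x in [set: V]) (a x)%:E)%E.

Lemma le_mass a b : (forall x, a x <= b x) -> (mass a <= mass b)%E.
Proof. by move=> ab; apply: le_esum => x _; rewrite lee_fin. Qed.

Lemma mass_ge0 a : (forall x, 0 <= a x) -> (0 <= mass a)%E.
Proof. by move=> a0; apply: esum_ge0 => x _; rewrite lee_fin. Qed.

Lemma mass_fin_num a : (forall x, 0 <= a x) -> (mass a < +oo)%E ->
  mass a \is a fin_num.
Proof. by move=> a0 aoo; rewrite ge0_fin_numE// mass_ge0. Qed.

Lemma massD a b : (forall x, 0 <= a x) -> (forall x, 0 <= b x) ->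
  mass (a \+ b) = (mass a + mass b)%E.
Proof.
by move=> a0 b0; rewrite -esumD// => x _; rewrite lee_fin.
Qed.

Lemma le_massZ (c : R) a : 0 <= c -> (forall x, 0 <= a x) ->
  (mass (fun x => c * a x)%R <= c%:E * mass a)%E.
Proof.
move=> c0 a0; rewrite ge_ereal_sup => // _ [F [finF FT] <-].
under eq_fsbigr do rewrite EFinM.
rewrite -ge0_mule_fsumr; last by move=> x; rewrite lee_fin.
apply: lee_wpmul2l; first by rewrite lee_fin.
by apply: ereal_sup_ubound; exists F.
Qed.

Lemma mass_finite F a : finite_set F -> (forall x, 0 <= a x) ->
  (forall x, ~ F x -> a x = 0) -> mass a = (\sum_(x \in F) a x)%:E.
Proof.
move=> finF a0 aF; rewrite -fsumEFin// -esum_fset//; last first.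
  by move=> x _; rewrite lee_fin.
rewrite [RHS]esum_mkcond; apply: eq_esum => x _.
by case: ifPn => // /negP; rewrite inE => /aF ->.
Qed.

(** The sum is a supremum over finite sets, so some finite set carries all of it
    up to [e]. *)
Lemma mass_tail a (e : R) : (forall x, 0 <= a x) -> (mass a < +oo)%E ->
  0 < e -> exists2 F, finite_set F &
    (mass (fun x => if x \in F then 0%R else a x) < e%:E)%E.
Proof.
move=> a0 aoo e0; have afin := mass_fin_num a0 aoo.
have [_ [F [finF _] <-] aF] := ub_ereal_sup_adherent e0 afin.
exists F => //; rewrite -/(esum _ _) -/(mass _) in aF.
have Fa : (\sum_(x \in F) (a x)%:E =
    mass (fun x => if x \in F then a x else 0%R))%E.
  rewrite -esum_fset//; last by move=> x _; rewrite lee_fin.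
  rewrite esum_mkcond; apply: eq_esum => x _; by case: ifP.
have aE : mass a = (mass (fun x => if x \in F then a x else 0%R)
    + mass (fun x => if x \in F then 0%R else a x))%E.
  rewrite -massD.
  - by apply: eq_esum => x _ /=; case: ifP; rewrite ?addr0 ?add0r.
  - by move=> x; case: ifP.
  - by move=> x; case: ifP.
move: aF afin; rewrite Fa aE.
move: (mass _) (mass _) => [s| |] [t| |]//=.
by rewrite -EFinD -EFinD !lte_fin => + _; lra.
Qed.

Lemma rsumB_ge0 a b : (forall x, 0 <= a x) -> (forall x, 0 <= b x) ->
  (mass a < +oo)%E -> (mass b < +oo)%E ->
  rsum (a \- b) = fine (mass a) - fine (mass b).
Proof.
move=> a0 b0 aoo boo; rewrite -fineB ?mass_fin_num// /rsum; congr fine.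
have sm c : (forall x, 0 <= c x) -> (mass c < +oo)%E ->
    summable setT (fun x => (c x)%:E).
  move=> c0; apply: le_lt_trans; apply: le_esum => x _ /=.
  by rewrite ger0_norm.
rewrite -(esumB (sm _ a0 aoo) (sm _ b0 boo))//.
- by move=> x _; rewrite lee_fin.
- by move=> x _; rewrite lee_fin.
Qed.

Lemma mass_normB_le h :
  (mass (fun x => `|h x| - h x)%R <=
   mass (fun x => `|h x|)%R + mass (fun x => `|h x|)%R)%E.
Proof.
rewrite -massD//; apply: le_mass => x /=.
by rewrite lerD2l -normrN ler_norm.
Qed.

Lemma mass_normB_ltey h : (mass (fun x => `|h x|)%R < +oo)%E ->
  (mass (fun x => `|h x| - h x)%R < +oo)%E.
Proof.
by move=> hoo; rewrite (le_lt_trans (mass_normB_le h))// lte_add_pinfty.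
Qed.

(** Writing [h] as [|h| - (|h| - h)], a difference of two nonnegative families
    that depend on [h] without case analysis, makes the linearity of [rsum] a
    matter of rearranging sums of nonnegative families. *)
Lemma rsumE h : (mass (fun x => `|h x|)%R < +oo)%E ->
  rsum h =
  fine (mass (fun x => `|h x|)%R) - fine (mass (fun x => `|h x| - h x)%R).
Proof.
move=> hoo.
rewrite -rsumB_ge0 ?mass_normB_ltey//.
  by congr rsum; apply/funext => x /=; ring.
by move=> x; rewrite subr_ge0 ler_norm.
Qed.

Lemma rsumB h k : (mass (fun x => `|h x|)%R < +oo)%E ->
  (mass (fun x => `|k x|)%R < +oo)%E -> rsum (h \- k) = rsum h - rsum k.
Proof.
move=> hoo koo.
have ge0 (j : V -> R) x : 0 <= `|j x| - j x by rewrite subr_ge0 ler_norm.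
have -> : h \- k = ((fun x => `|h x|) \+ (fun x => `|k x| - k x))
                  \- ((fun x => `|k x|) \+ (fun x => `|h x| - h x)).
  by apply/funext => x /=; ring.
rewrite rsumB_ge0; last 4 first.
- by move=> x; rewrite addr_ge0//; exact: (ge0 k).
- by move=> x; rewrite addr_ge0//; exact: (ge0 h).
- by rewrite massD//; apply: lte_add_pinfty => //; exact: mass_normB_ltey.
- by rewrite massD//; apply: lte_add_pinfty => //; exact: mass_normB_ltey.
rewrite (massD _ (ge0 k))// (massD _ (ge0 h))//.
have finN (j : V -> R) : (mass (fun x => `|j x|)%R < +oo)%E ->
    mass (fun x => `|j x|)%R \is a fin_num by move=> joo; rewrite mass_fin_num.
have finB (j : V -> R) : (mass (fun x => `|j x|)%R < +oo)%E ->
    mass (fun x => `|j x| - j x)%R \is a fin_num.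
  by move=> joo; rewrite mass_fin_num// mass_normB_ltey.
rewrite !fineD; [|exact: finN|exact: finB|exact: finN|exact: finB].
by rewrite !rsumE//; ring.
Qed.

Lemma rsum_le h : (mass (fun x => `|h x|)%R < +oo)%E ->
  `|rsum h| <= fine (mass (fun x => `|h x|)%R).
Proof.
move=> hoo; rewrite rsumE//.
have ge0 x : 0 <= `|h x| - h x by rewrite subr_ge0 ler_norm.
have fin1 : mass (fun x => `|h x|) \is a fin_num by rewrite mass_fin_num.
have fin2 : mass (fun x => `|h x| - h x)%R \is a fin_num.
  by rewrite mass_fin_num// mass_normB_ltey.
have := mass_ge0 ge0; move: (mass_normB_le h) fin1 fin2.
move: (mass _) (mass _) => [s| |] [t| |]//= + _ _.
rewrite -EFinD !lee_fin ler_norml => st s0; apply/andP; split; lra.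
Qed.

Lemma rsum_finite F h : finite_set F -> (forall x, ~ F x -> h x = 0) ->
  rsum h = \sum_(x \in F) h x.
Proof.
move=> finF hF.
have mass1 : mass (fun x => `|h x|) = (\sum_(x \in F) `|h x|)%:E.
  by apply: mass_finite => // x /hF ->; rewrite normr0.
have mass2 : mass (fun x => `|h x| - h x)%R =
    (\sum_(x \in F) (`|h x| - h x))%:E.
  apply: mass_finite => // x; first by rewrite subr_ge0 ler_norm.
  by move=> /hF ->; rewrite normr0 subr0.
rewrite rsumE; last by rewrite mass1 ltry.
rewrite mass1 mass2 /= !fsbig_finite// -sumrB.
by apply: eq_bigr => x _; ring.
Qed.
End SummableFamilies.

(** * Unconditional sums of complex families *)

Section ComplexSums.
Context {R : realType} {V : countType}.
Implicit Types (f g h : V -> R[i]) (F : set V).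
Local Notation normc := (@Normc.normc R).

Lemma normc_sqrE (z : R[i]) :
  normc z ^+ 2 = complex.Re z ^+ 2 + complex.Im z ^+ 2.
Proof. by case: z => a b /=; rewrite sqr_sqrtr// addr_ge0// sqr_ge0. Qed.

Lemma normc_ge0 (z : R[i]) : 0 <= normc z.
Proof. by case: z => a b /=; rewrite sqrtr_ge0. Qed.

Lemma normRe_le (z : R[i]) : `|complex.Re z| <= normc z.
Proof. by case: z => a b /=; rewrite -sqrtr_sqr ler_wsqrtr// lerDl sqr_ge0. Qed.

Lemma normIm_le (z : R[i]) : `|complex.Im z| <= normc z.
Proof. by case: z => a b /=; rewrite -sqrtr_sqr ler_wsqrtr// lerDr sqr_ge0. Qed.

Lemma normc_le (z : R[i]) : normc z <= `|complex.Re z| + `|complex.Im z|.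
Proof.
rewrite -(@ler_pXn2r _ 2)//; try by rewrite nnegrE ?normc_ge0 ?addr_ge0.
rewrite sqrrD !real_normK ?num_real// normc_sqrE.
by rewrite -addrA lerD2l lerDr mulrn_wge0// mulr_ge0.
Qed.

Lemma csumB f g : (mass (normc \o f) < +oo)%E -> (mass (normc \o g) < +oo)%E ->
  csum (f \- g) = csum f - csum g.
Proof.
move=> foo goo.
have Re_oo h : (mass (normc \o h) < +oo)%E ->
    (mass (fun x => `|complex.Re (h x)| : R)%R < +oo)%E.
  by apply: le_lt_trans; apply: le_mass => x; exact: normRe_le.
have Im_oo h : (mass (normc \o h) < +oo)%E ->
    (mass (fun x => `|complex.Im (h x)| : R)%R < +oo)%E.
  by apply: le_lt_trans; apply: le_mass => x; exact: normIm_le.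
rewrite /csum; apply/eqP; rewrite eq_complex /=; apply/andP; split; apply/eqP.
- rewrite -rsumB ?Re_oo//; congr rsum; apply/funext => x /=.
  by case: (f x) (g x) => [? ?] [? ?].
- rewrite -rsumB ?Im_oo//; congr rsum; apply/funext => x /=.
  by case: (f x) (g x) => [? ?] [? ?].
Qed.

Lemma csum_le f : (mass (normc \o f) < +oo)%E ->
  normc (csum f) <= 2 * fine (mass (normc \o f)).
Proof.
move=> foo; apply: le_trans (normc_le _) _; rewrite /csum /= mulr_natl mulr2n.
have ge0 : forall x, 0 <= (normc \o f) x by move=> x; exact: normc_ge0.
have bound (h : V -> R) : (forall x, `|h x| <= normc (f x)) ->
    `|rsum h| <= fine (mass (normc \o f)).
  move=> hf; have htot : (mass (fun x => `|h x|)%R <= mass (normc \o f))%E.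
    exact: le_mass.
  apply: le_trans (rsum_le (le_lt_trans htot foo)) _.
  by apply: fine_le => //; apply: mass_fin_num => //; exact: le_lt_trans foo.
by rewrite lerD// bound// => x; [exact: normRe_le|exact: normIm_le].
Qed.

Lemma csum_finite F f : finite_set F -> (forall x, ~ F x -> f x = 0) ->
  csum f = \sum_(x \in F) f x.
Proof.
move=> finF fF; rewrite /csum !(@rsum_finite _ _ F)//; try by move=> x /fF ->.
rewrite !fsbig_finite//; elim/big_rec3: _ => //= x a b z _ <-.
by case: (f x).
Qed.

Lemma csum_conj f : (mass (normc \o f) < +oo)%E ->
  csum (fun x => conjc (f x)) = conjc (csum f).
Proof.
move=> foo; rewrite /csum /=; congr (_ +i* _).
  by congr rsum; apply/funext => x; case: (f x).
have rsum0 : rsum (fun _ : V => 0 : R) = 0.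
  by rewrite (@rsum_finite _ V set0)// fsbig_set0.
rewrite -sub0r -rsum0 -rsumB.
- by congr rsum; apply/funext => x /=; rewrite sub0r; case: (f x).
- by rewrite (@mass_finite _ _ set0) ?fsbig_set0 ?ltry// => x _; rewrite normr0.
- by apply: le_lt_trans foo; apply: le_mass => x; exact: normIm_le.
Qed.
End ComplexSums.

(** * The inner product of l^2 and closures of operators *)

Section HilbertSpace.
Context {R : realType} {V : countType}.
Implicit Types (f g u v : V -> R[i]) (F : set V) (T : operator R V).
Local Notation normc := (@Normc.normc R).
Local Notation sqnorm f := (fun x => normc (f x) ^+ 2).

Lemma sqnorm_ge0 f x : 0 <= sqnorm f x.
Proof. by rewrite exprn_ge0// normc_ge0. Qed.
#[local] Hint Resolve sqnorm_ge0 : core.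

Lemma l2_fin_num f : l2 f -> l2normsq f \is a fin_num.
Proof. by move=> f2; apply: mass_fin_num. Qed.

Lemma l2_finite F f : finite_set F -> (forall x, ~ F x -> f x = 0) -> l2 f.
Proof.
move=> finF fF; rewrite /l2 /= [l2normsq f](@mass_finite _ _ F) ?ltry//.
by move=> x /fF ->; rewrite Normc.normc0 expr0n.
Qed.

Lemma normcB_sqr_le (a b : R[i]) :
  normc (a - b) ^+ 2 <= 2 * normc a ^+ 2 + 2 * normc b ^+ 2.
Proof.
rewrite !normc_sqrE; case: a b => [a a'] [b b'] /=.
have := sqr_ge0 (a + b); have := sqr_ge0 (a' + b'); nra.
Qed.

Lemma l2B f g : l2 f -> l2 g -> l2 (f \- g).
Proof.
move=> f2 g2.
have le : (l2normsq (f \- g)%R <= 2%:E * l2normsq f + 2%:E * l2normsq g)%E.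
  apply: (@le_trans _ _ (mass ((fun x => 2 * sqnorm f x) \+
      (fun x => 2 * sqnorm g x))%R)).
    by apply: le_mass => x; exact: normcB_sqr_le.
  rewrite massD; last 2 first.
  - by move=> x; rewrite mulr_ge0.
  - by move=> x; rewrite mulr_ge0.
  by apply: leeD; apply: le_massZ.
apply: le_lt_trans le _.
rewrite -(fineK (l2_fin_num f2)) -(fineK (l2_fin_num g2)).
by rewrite -!EFinM -EFinD ltry.
Qed.

Lemma normc_conj_mul (a b : R[i]) : normc (conjc a * b) = normc a * normc b.
Proof.
by rewrite Normc.normcM; congr (_ * _); case: a => a a' /=; rewrite sqrrN.
Qed.

(** The inequality 2ab <= t a^2 + b^2 / t, used here and in [l2dot_le] with a
    free parameter [t], replaces the Cauchy-Schwarz inequality and avoids taking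
    square roots of norms. *)
Lemma l2dot_mass_le f g (t : R) : 0 < t ->
  (mass (fun x => normc (conjc (f x) * g x))%R <=
   (t / 2)%:E * l2normsq f + (t^-1 / 2)%:E * l2normsq g)%E.
Proof.
move=> t0; have ti0 : 0 < t^-1 by rewrite invr_gt0.
apply: (@le_trans _ _ (mass ((fun x => t / 2 * sqnorm f x) \+
    (fun x => t^-1 / 2 * sqnorm g x))%R)).
  apply: le_mass => x /=; rewrite normc_conj_mul.
  move: (normc (f x)) (normc (g x)) => a b.
  have : 0 <= t^-1 * (t * a - b) ^+ 2 by rewrite mulr_ge0 ?sqr_ge0// ltW.
  have -> : t^-1 * (t * a - b) ^+ 2 = t * a ^+ 2 - 2 * (a * b) + t^-1 * b ^+ 2.
    by field; rewrite gt_eqF.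
  by move=> h; lra.
rewrite massD; last 2 first.
- by move=> x; rewrite mulr_ge0// divr_ge0// ltW.
- by move=> x; rewrite mulr_ge0// divr_ge0// ltW.
by apply: leeD; apply: le_massZ => //; rewrite divr_ge0// ltW.
Qed.

Lemma l2dot_summable f g : l2 f -> l2 g ->
  (mass (fun x => normc (conjc (f x) * g x))%R < +oo)%E.
Proof.
move=> f2 g2; apply: le_lt_trans (l2dot_mass_le _ _ ltr01) _.
rewrite -(fineK (l2_fin_num f2)) -(fineK (l2_fin_num g2)).
by rewrite -!EFinM -EFinD ltry.
Qed.

Lemma l2dot_le f g (t : R) : 0 < t -> l2 f -> l2 g ->
  normc (l2dot f g) <= t * fine (l2normsq f) + t^-1 * fine (l2normsq g).
Proof.
move=> t0 f2 g2; apply: le_trans (csum_le (l2dot_summable f2 g2)) _.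
have := l2dot_mass_le f g t0.
rewrite -[in X in X -> _](fineK (l2_fin_num f2)).
rewrite -[in X in X -> _](fineK (l2_fin_num g2)).
rewrite -[in X in X -> _](@fineK _ (mass _)).
  rewrite -!EFinM -EFinD lee_fin => h.
  apply: le_trans (ler_wpM2l _ h) _ => //.
  by rewrite le_eqVlt; apply/orP; left; apply/eqP; field; rewrite gt_eqF.
by apply: mass_fin_num (l2dot_summable f2 g2) => x; exact: normc_ge0.
Qed.

Lemma l2dotBr f u v : l2 f -> l2 u -> l2 v ->
  l2dot f (u \- v) = l2dot f u - l2dot f v.
Proof.
move=> f2 u2 v2; rewrite /l2dot -csumB; try exact: l2dot_summable.
by congr csum; apply/funext => x /=; rewrite mulrBr.
Qed.

Lemma l2dotC f g : l2 f -> l2 g -> l2dot f g = conjc (l2dot g f).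
Proof.
move=> f2 g2; rewrite /l2dot -csum_conj; last exact: l2dot_summable.
by congr csum; apply/funext => x; rewrite rmorphM /= conjcK mulrC.
Qed.

Lemma op_closure_sub T :
  (forall p, T p -> l2 p.1 /\ l2 p.2) -> T `<=` op_closure T.
Proof.
move=> T2 p Tp; have [p1 p2] := T2 _ Tp; split => // e e0; exists p => //.
suff z u : l2normsq (u \- u) = 0%E by rewrite !z lte_fin.
rewrite [l2normsq _](@mass_finite _ _ set0) ?fsbig_set0// => x _.
by rewrite /= subrr Normc.normc0 expr0n.
Qed.

(** The relation [<f, v> = <g, u>] passes to the limit in [(u, v)] because the
    inner product is continuous. *)
Lemma op_adjoint_closure T : op_adjoint T `<=` op_adjoint (op_closure T).
Proof.
move=> [f g] [f2 g2 fg]; split => // -[u v] [u2 v2 uv].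
change (l2dot f v = l2dot g u).
apply/eqP; rewrite -subr_eq0; apply/eqP/Normc.eq0_normc/eqP.
rewrite eq_le normc_ge0 andbT; apply/ler_addgt0Pr => e e0; rewrite add0r.
(* If (u', v') in T is within t of (u, v), the defect is at most
   t (|f|^2 + |g|^2) + (t^2 + t^2) / t = t K, and t is chosen to make it e. *)
set K := fine (l2normsq f) + fine (l2normsq g) + 2.
have K0 : 0 < K.
  by rewrite ltr_wpDl// addr_ge0// fine_ge0// mass_ge0.
pose t := e / K; have t0 : 0 < t by rewrite divr_gt0.
have [[u' v'] Tq [uu' vv']] := uv (t ^+ 2) (exprn_gt0 _ t0).
have near_l2 (w w' : V -> R[i]) : l2 w ->
    (l2normsq (w' \- w)%R < (t ^+ 2)%:E)%E ->
    l2 w' /\ fine (l2normsq (w' \- w)%R) <= t ^+ 2.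
  move=> w2 ww'; have d2 : l2 (w' \- w) by rewrite /l2 /= (lt_trans ww')// ltry.
  split; last by rewrite -lee_fin fineK ?l2_fin_num// ltW.
  have w0 : l2 (fun x : V => 0 : R[i]) by apply: (@l2_finite set0).
  have -> : w' = (w' \- w) \- ((fun x : V => 0) \- w).
    by apply/funext => x /=; rewrite sub0r opprK subrK.
  by apply: l2B => //; exact: l2B.
have [u'2 du] := near_l2 _ _ u2 uu'; have [v'2 dv] := near_l2 _ _ v2 vv'.
have -> : l2dot f v - l2dot g u = l2dot g (u' \- u) - l2dot f (v' \- v).
  by rewrite !l2dotBr// (fg _ Tq); ring.
apply: (@le_trans _ _ (normc (l2dot g (u' \- u)) + normc (l2dot f (v' \- v)))).
  by rewrite -[X in _ <= _ + X]normcN; exact: le_normcD.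
apply: le_trans (lerD (l2dot_le t0 g2 _) (l2dot_le t0 f2 _)) _; try exact: l2B.
have ti0 : 0 <= t^-1 by rewrite invr_ge0 ltW.
have tt : t^-1 * t ^+ 2 = t by field; rewrite gt_eqF.
have := ler_wpM2l ti0 du; have := ler_wpM2l ti0 dv; rewrite tt.
have -> : e = t * K by rewrite /t divfK// gt_eqF.
rewrite /K; lra.
Qed.

(** Symmetry says [T <= T^*], and [T^*] is also the adjoint of the closure
    [T^-] of [T].  Exchanging the roles of the two operators, [T <= (T^-)^*]
    turns into [T^- <= T^*], that is [T^- <= (T^-)^*]; conversely
    [(T^-)^* <= T^*], which the second hypothesis places below [T^-]. *)
Lemma symmetric_essentially_selfadjoint T :
  T `<=` op_adjoint T -> op_adjoint T `<=` op_closure T ->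
  essentially_selfadjoint T.
Proof.
move=> symT adjT; have Tcl : T `<=` op_closure T.
  by apply: op_closure_sub => p /symT[].
apply/seteqP; split; last first.
  move=> p [p1 p2 pT]; apply: adjT; split => // q /Tcl; exact: pT.
(* Exchange of roles: complex conjugation swaps the two sides of the pairing. *)
have clT : op_closure T `<=` op_adjoint T.
  move=> p clp; have [p1 p2 _] := clp; split => // q Tq.
  have [q1 q2 qcl] := op_adjoint_closure (symT _ Tq).
  rewrite (l2dotC p1 q2) (l2dotC p2 q1); congr conjc.
  by rewrite qcl.
exact: subset_trans clT (@op_adjoint_closure _).
Qed.

End HilbertSpace.

(** * Adjacency matrices with bounded weight sums *)

Lemma eq_fsum_support (M : nmodType) (T : choiceType) (P Q : set T)
    (t : T -> M) :
  (forall y, t y != 0 -> P y) -> (forall y, t y != 0 -> Q y) ->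
  \sum_(y \in P) t y = \sum_(y \in Q) t y.
Proof.
move=> tP tQ; rewrite fsbig_supp [RHS]fsbig_supp; apply: eq_fsbigl.
apply/seteqP; split => y [_ /eqP ty]; split; try exact/eqP.
- exact: tQ.
- exact: tP.
Qed.

Lemma mass_fsum_exchange (R : realType) (V : countType) (P : V -> set V)
    (k : V -> V -> R) :
  (forall x, finite_set (P x)) -> (forall x y, P x y -> P y x) ->
  (forall x y, 0 <= k x y) ->
  mass (fun x => \sum_(y \in P x) k x y) =
  mass (fun y => \sum_(x \in P y) k x y).
Proof.
move=> finP symP k0.
have inner (m : V -> V -> R) x : (forall x y, 0 <= m x y) ->
    (\sum_(y \in P x) m x y)%:E = (\esum_(y in P x) (m x y)%:E)%E.
  by move=> m0; rewrite esum_fset ?fsumEFin// => y _; rewrite lee_fin.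
rewrite /mass; under eq_esum do rewrite inner//.
under [RHS]eq_esum do rewrite (inner (fun y x => k x y))//.
rewrite !esum_esum; try by move=> *; rewrite lee_fin.
rewrite (reindex_esum (setT `*`` P) _ (fun z => (z.2, z.1)))//; split => //=.
- by move=> [x y] /= [_ Pxy]; split => //; exact: symP.
- by move=> [x y] [x' y'] _ _ /= [-> ->].
- by move=> [y x] /= [_ Pyx]; exists (x, y) => //=; split => //; exact: symP.
Qed.

Section Adjacency.
Context {R : realType} {V : countType} (E : wgraph R V).
Implicit Types (f g h u : V -> R[i]) (F : set V).
Local Notation normc := (@Normc.normc R).
Local Notation A := (adjacency_fun E).

Definition row_sum x : R := \sum_(y \in neighbors E x) E x y.

Lemma finite_neighbors x : finite_set (neighbors E x).
Proof. exact: weight_locally_finite. Qed.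
#[local] Hint Resolve finite_neighbors : core.

Lemma neighbors_sym x y : neighbors E x y -> neighbors E y x.
Proof. by rewrite /neighbors /= weight_sym. Qed.

Definition neighborhood F := \bigcup_(y in F) neighbors E y.

Lemma finite_neighborhood F : finite_set F -> finite_set (neighborhood F).
Proof. by move=> finF; apply: bigcup_finite. Qed.

Lemma adjacency_fun_outside F u : (forall x, ~ F x -> u x = 0) ->
  forall x, ~ neighborhood F x -> A u x = 0.
Proof.
move=> uF x Nx; rewrite /adjacency_fun fsbig1// => y xy.
rewrite uF ?mulr0// => Fy; apply: Nx; exists y => //; exact: neighbors_sym.
Qed.

(** Only [u] needs finite support: both sides are then sums over the finitely
    many edges that meet the support of [u]. *)
Lemma l2dot_adjacency f u : Cc u -> l2dot f (A u) = l2dot (A f) u.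
Proof.
rewrite /Cc /=; set F := [set x | _] => finF.
have uF x : ~ F x -> u x = 0 by move=> /negP; rewrite negbK => /eqP.
have finN := finite_neighborhood finF.
transitivity (\sum_(x \in neighborhood F) \sum_(y \in F)
    conjc (f x) * ((E x y)%:C * u y)).
  rewrite /l2dot (@csum_finite _ _ (neighborhood F))//; last first.
    by move=> x /(adjacency_fun_outside uF) ->; rewrite mulr0.
  apply: eq_fsbigr => x _; rewrite -mulr_fsumr; congr (_ * _).
  apply: eq_fsum_support => y; rewrite mulf_eq0 negb_or => /andP[Exy uy] //.
  by rewrite /neighbors /=; apply: contra_neq Exy => ->.
rewrite exchange_fsbig// /l2dot (@csum_finite _ _ F)//; last first.
  by move=> y /uF ->; rewrite mulr0.
apply: eq_fsbigr => y; rewrite inE => Fy.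
have -> : conjc (A f y) = \sum_(x \in neighbors E y) (E x y)%:C * conjc (f x).
  rewrite /adjacency_fun !fsbig_finite// rmorph_sum /=; apply: eq_bigr => x _.
  by rewrite rmorphM /= weight_sym; congr (_ * _); rewrite /= oppr0.
rewrite mulr_fsuml.
rewrite (@eq_fsum_support _ _ (neighborhood F) (neighbors E y)).
- by apply: eq_fsbigr => x _; ring.
- move=> x; rewrite !mulf_eq0 !negb_or => /and3P[_ Exy _].
  exists y => //; rewrite /neighbors /= weight_sym.
  by apply: contra_neq Exy => ->.
- move=> x; rewrite !mulf_eq0 !negb_or => /and3P[_ Exy _].
  rewrite /neighbors /= weight_sym.
  by apply: contra_neq Exy => ->.
Qed.

Lemma adjacency_symmetric : adjacency E `<=` op_adjoint (adjacency E).
Proof.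
move=> _ [f /= fc <-]; split => /=.
- by apply: (l2_finite fc) => x /negP; rewrite negbK => /eqP.
- apply: (l2_finite (finite_neighborhood fc)); apply: adjacency_fun_outside.
  by move=> x /negP; rewrite negbK => /eqP.
- by move=> _ [u uc <-]; exact: l2dot_adjacency.
Qed.

(** Pairing with the indicator of a vertex evaluates [g] and [A f] there. *)
Lemma adjoint_adjacencyE f g : op_adjoint (adjacency E) (f, g) -> g = A f.
Proof.
move=> [_ _ /= fg]; apply/funext => x.
pose d y : R[i] := (y == x)%:R.
have dx y : ~ [set x] y -> d y = 0 by move=> /eqP yx; rewrite /d (negbTE yx).
have dc : Cc d.
  apply: sub_finite_set (finite_set1 x) => y.
  by apply: contraPP => /dx /= ->; rewrite eqxx.
have pick h : l2dot h d = conjc (h x).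
  rewrite /l2dot (@csum_finite _ _ [set x])//; last first.
    by move=> y /dx ->; rewrite mulr0.
  by rewrite fsbig_set1 /d eqxx mulr1.
have := fg (d, A d) (imageP _ dc); rewrite /= l2dot_adjacency// !pick.
by move=> /(congr1 conjc); rewrite !conjcK.
Qed.

(** Cauchy-Schwarz for the weights [E x y], obtained from the nonnegativity of
    the weighted sum of the [(|h y| - t)^2]. *)
Lemma sqr_adjacency_fun_le (C : R) h x : 0 < C -> row_sum x <= C ->
  normc (A h x) ^+ 2 <= C * \sum_(y \in neighbors E x) E x y * normc (h y) ^+ 2.
Proof.
move=> C0 rowC; set r := fset_set (neighbors E x).
have normE y : normc ((E x y)%:C * h y) = E x y * normc (h y).
  by rewrite Normc.normcM /= expr0n /= addr0 sqrtr_sqr ger0_norm// weight_ge0.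
set S2 := \sum_(y \in _) _; set S1 := \sum_(y <- r) E x y * normc (h y).
have le1 : normc (A h x) <= S1.
  rewrite /adjacency_fun /S1 fsbig_finite//.
  elim/big_rec2: _ => [|y a b _ ab]; first by rewrite Normc.normc0.
  by apply: le_trans (le_normcD _ _) _; rewrite normE lerD2l.
have S10 : 0 <= S1 by apply: le_trans le1; exact: normc_ge0.
apply: (@le_trans _ _ (S1 ^+ 2)).
  by rewrite ler_pXn2r// nnegrE normc_ge0.
(* The value of t that minimises S2 - 2 t S1 + C t^2. *)
pose t := S1 / C.
have : 0 <= \sum_(y <- r) E x y * (normc (h y) - t) ^+ 2.
  by apply: sumr_ge0 => y _; rewrite mulr_ge0 ?weight_ge0 ?sqr_ge0.
have -> : \sum_(y <- r) E x y * (normc (h y) - t) ^+ 2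
    = S2 - 2 * t * S1 + row_sum x * t ^+ 2.
  rewrite /S2 /S1 /row_sum !fsbig_finite// mulr_sumr mulr_suml.
  rewrite -sumrB -big_split /=.
  by apply: eq_bigr => y _; ring.
have tC : t * C = S1 by rewrite /t divfK// gt_eqF.
have := ler_wpM2r (sqr_ge0 t) rowC.
have -> : S1 ^+ 2 = C * (2 * t * S1 - C * t ^+ 2) by rewrite -tC; ring.
by move=> rt S2t; rewrite ler_pM2l//; lra.
Qed.

(** Schur's test: the pointwise bound costs one factor [C]; the other comes from
    exchanging the two sums, since by symmetry the weights arriving at a vertex
    also sum to at most [C]. *)
Lemma l2normsq_adjacency_le (C : R) h : 0 < C -> (forall x, row_sum x <= C) ->
  (l2normsq (A h) <= (C ^+ 2)%:E * l2normsq h)%E.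
Proof.
move=> C0 rowC; set b := fun x => normc (h x) ^+ 2.
have b0 x : 0 <= b x by rewrite exprn_ge0// normc_ge0.
have kb0 x y : 0 <= E x y * b y by rewrite mulr_ge0// weight_ge0.
apply: (@le_trans _ _ (mass (fun x =>
    C * \sum_(y \in neighbors E x) E x y * b y)%R)).
  by apply: le_mass => x; exact: sqr_adjacency_fun_le.
apply: (@le_trans _ _ (C%:E * mass (fun x =>
    \sum_(y \in neighbors E x) E x y * b y)%R)%E).
  by apply: le_massZ => [|x]; [exact: ltW|exact: fsumr_ge0].
rewrite expr2 EFinM -muleA; apply: lee_wpmul2l; first by rewrite lee_fin ltW.
rewrite mass_fsum_exchange//; last exact: neighbors_sym.
apply: le_trans (le_massZ (ltW C0) b0); apply: le_mass => y.
rewrite -mulr_fsuml ler_wpM2r//; apply: le_trans (rowC y).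
rewrite le_eqVlt /row_sum; apply/orP; left; apply/eqP/eq_fsbigr => x _.
by rewrite weight_sym.
Qed.

(** The truncation [fF] of [f] to a finite set carrying almost all of [f] has an
    image close to [A f] by Schur's test. *)
Lemma bounded_row_sum_essentially_selfadjoint (C : R) :
  (forall x, row_sum x <= C) -> essentially_selfadjoint (adjacency E).
Proof.
move=> rowC; have C0 : 0 < Num.max C 1 by rewrite lt_max ltr01 orbT.
have {}rowC x : row_sum x <= Num.max C 1 by rewrite le_max rowC.
move: (Num.max C 1) C0 rowC => {}C C0 rowC.
apply: symmetric_essentially_selfadjoint; first exact: adjacency_symmetric.
move=> [f g] fg; have [f2 g2 _] := fg; move: g2.
rewrite (adjoint_adjacencyE fg) => Af2; split => //= e e0.
(* D dominates both 1 and C^2, so it controls the tail of f and its image. *)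
pose D := C ^+ 2 + 1.
have D0 : 0 < D by rewrite ltr_wpDl// exprn_ge0// ltW.
have [F finF Fe] := mass_tail (fun x => exprn_ge0 2 (normc_ge0 (f x))) f2
  (divr_gt0 e0 D0).
pose fF x := if x \in F then f x else 0.
have tailE : l2normsq (fF \- f)%R =
    mass (fun x => if x \in F then 0 else normc (f x) ^+ 2).
  apply: eq_esum => x _; congr EFin; rewrite /= /fF; case: ifP => _.
    by rewrite subrr Normc.normc0 expr0n.
  by rewrite sub0r normcN.
have AB : A fF \- A f = A (fF \- f).
  apply/funext => x; rewrite /adjacency_fun /= !fsbig_finite// -sumrB.
  by apply: eq_bigr => y _; rewrite mulrBr.
exists (fF, A fF) => /=.
  exists fF => //; apply: sub_finite_set finF => x /=; rewrite /fF.
  by case: ifPn; [rewrite inE|rewrite eqxx].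
have small : (D%:E * l2normsq (fF \- f)%R < e%:E)%E.
  rewrite tailE; rewrite -lte_pdivlMl// in Fe *.
  by rewrite -EFinM mulrC.
rewrite AB; split; apply: le_lt_trans small.
  rewrite -[X in (X <= _)%E]mul1e; apply: lee_wpmul2r.
    by apply: mass_ge0 => x; exact: sqnorm_ge0.
  by rewrite lee_fin /D lerDr exprn_ge0// ltW.
apply: le_trans (l2normsq_adjacency_le _ C0 rowC) _.
apply: lee_wpmul2r; first by apply: mass_ge0 => x; exact: sqnorm_ge0.
by rewrite lee_fin /D lerDl.
Qed.
End Adjacency.

(** * Surgery *)

Lemma row_sum_simple (R : realType) (V : countType) (E : wgraph R V) x :
  simple_graph E -> row_sum E x = (degree E x)%:R.
Proof.
move=> simpleE; rewrite /row_sum /degree.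
rewrite fsbig_finite; last exact: finite_neighbors.
rewrite big_seq (eq_bigr (fun=> 1)) -?big_seq => [|y].
  by rewrite big_const_seq count_predT iter_addr_0.
rewrite in_fset_set ?inE; last exact: finite_neighbors.
by rewrite /neighbors /=; case: (simpleE x y) => ->; rewrite ?eqxx.
Qed.

(** The edges that surgery adds at a vertex of [V n] all start at [x n]. *)
Lemma surgery_row_sum (R : realType) (I : countType) (V : I -> countType)
    (E_ : forall n, wgraph R (V n)) (E : wgraph R {n : I & V n})
    (x : forall n, V n) :
  (forall n (u v : V n), E (Tagged V u) (Tagged V v) = E_ n u v) ->
  (forall n m (u : V n) (v : V m), n != m -> ~ (u = x n /\ v = x m) ->
    E (Tagged V u) (Tagged V v) = 0) ->
  forall n (u : V n), u <> x n -> row_sum E (Tagged V u) = row_sum (E_ n) u.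
Proof.
move=> inE_ outE n u ux.
have -> : row_sum E (Tagged V u) =
    \sum_(y \in (fun v => Tagged V v) @` neighbors (E_ n) u) E (Tagged V u) y.
  apply: eq_fsbigl; apply/seteqP; split => [[m v]|_ [v Ev <-]].
    rewrite /neighbors /=; have [nm|nm] := eqVneq n m.
      by case: m / nm v => v; rewrite inE_ => Ev; exists v.
    by rewrite outE ?eqxx// => -[].
  by rewrite /neighbors /= inE_.
rewrite fsbig_image; first by apply: eq_fsbigr => v _; rewrite inE_.
by move=> v w _ _ /eqP; rewrite eq_Tagged /= => /eqP.
Qed.

Theorem corollary3p1 (R : realType) (N : nat) (V : 'I_N -> countType)
    (G_ : forall n : 'I_N, wgraph R (V n))
    (simpleG : forall n : 'I_N, simple_graph (G_ n))
    (degreeG : forall n : 'I_N, constant_degree (G_ n))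
    (G : wgraph R {n : 'I_N & V n})
    (surgeryG : surgery G_ G) :
  essentially_selfadjoint (adjacency G).
Proof.
have [x [M [_ inG outG _]]] := surgeryG.
have [d dG] := choice degreeG.
have row_sum_ge0 y : 0 <= row_sum G y.
  by apply: fsumr_ge0 => z _; exact: weight_ge0.
(* d n bounds the vertices of V n other than x n, the second term bounds x n. *)
pose c n := (d n)%:R + row_sum G (Tagged V (x n)).
have c0 n : 0 <= c n by rewrite addr_ge0.
apply: (@bounded_row_sum_essentially_selfadjoint _ _ _ (\sum_n c n)) => -[n u].
apply: (@le_trans _ _ (c n)); last first.
  by rewrite (bigD1 n)//= lerDl sumr_ge0.
have [->|/eqP ux] := eqVneq u (x n); first by rewrite lerDr.
by rewrite (surgery_row_sum inG outG ux) row_sum_simple// dG lerDl.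
Qed.
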